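(* Let $(X,d)$ be a compact metric space, $\boldsymbol f=\{f_i\}_{i=1}^\infty$ a sequence of continuous self-maps of $X$, $\varphi\in C(X,\mathbb R)$, and let $Z\subseteq X$ be nonempty. Then the maps $\theta\mapsto\underline P(\boldsymbol f,Z,\varphi,\theta)$ and $\theta\mapsto\overline P(\boldsymbol f,Z,\varphi,\theta)$ (lower and upper $\theta$-intermediate topological pressures) are continuous for $\theta\in(0,1]$.
   Context: Pressures take values in $[-\infty,+\infty]$. $C(X,\mathbb R)$ is the space of continuous real functions on $X$ with the supremum norm. Put $f_1^0=\mathrm{id}_X$, $f_1^n=f_n\circ\cdots\circ f_1$ for $n\ge1$, and $S_n\varphi(x)=\sum_{j=0}^{n-1}\varphi(f_1^j x)$. For a finite open cover $\mathcal U$ of $X$, $\mathcal S_m(\mathcal U)$ is the set of strings $\mathbf U=(U_0,\dots,U_{m-1})$ with all $U_j\in\mathcal U$; $m(\mathbf U)=m$ is the length of $\mathbf U$; and $X(\mathbf U)=\{x\in X: f_1^j(x)\in U_j,\ 0\le j\le m-1\}$. For $Z\subseteq X$, $\alpha\in\mathbb R$, $N\in\mathbb N$, $\theta\in[0,1]$ let $$M(Z,\alpha,\varphi,\mathcal U,N,\theta)=\inf_{\mathcal G}\sum_{\mathbf U\in\mathcal G}\exp\Bigl(-\alpha m(\mathbf U)+\sup_{x\in X(\mathbf U)}S_{m(\mathbf U)}\varphi(x)\Bigr),$$ the infimum over all finite or countable collections $\mathcal G$ of strings of lengths $m$ with $N\le m<N/\theta+1$ (for $\theta=0$: $m\ge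 N$) such that $Z\subseteq\bigcup_{\mathbf U\in\mathcal G}X(\mathbf U)$; the supremum over an empty $X(\mathbf U)$ is $-\infty$ (so the term is $0$). Let $\underline m$ and $\overline m$ be the $\liminf$ and $\limsup$ of $M(Z,\alpha,\varphi,\mathcal U,N,\theta)$ as $N\to\infty$, and $$\underline P(\boldsymbol f,Z,\varphi,\mathcal U,\theta)=\inf\{\alpha:\underline m=0\}=\sup\{\alpha:\underline m=\infty\},\quad \overline P(\boldsymbol f,Z,\varphi,\mathcal U,\theta)=\inf\{\alpha:\overline m=0\}=\sup\{\alpha:\overline m=\infty\}.$$ With $|\mathcal U|=\max_{U\in\mathcal U}\operatorname{diam}U$, the lower and upper $\theta$-intermediate topological pressures are $\underline P(\boldsymbol f,Z,\varphi,\theta)=\lim_{|\mathcal U|\to0}\underline P(\boldsymbol f,Z,\varphi,\mathcal U,\theta)$ and $\overline P(\boldsymbol f,Z,\varphi,\theta)=\lim_{|\mathcal U|\to0}\overline P(\boldsymbol f,Z,\varphi,\mathcal U,\theta)$ (these limits exist). *)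

(* Defs.v *)
From HB Require Import structures.
From mathcomp Require Import all_boot all_order all_algebra.
From mathcomp Require Import all_classical all_reals all_analysis.
Set Implicit Arguments.
Unset Strict Implicit.
Unset Printing Implicit Defensive.
Import Order.TTheory GRing.Theory Num.Theory.
Import numFieldNormedType.Exports.
Local Open Scope classical_set_scope.
Local Open Scope ring_scope.

(** The sequence of maps is [f 1, f 2, ...]; the value [f 0] is never used. *)

Fixpoint orbit_map (X : Type) (f : nat -> X -> X) (n : nat) : X -> X :=
  if n is m.+1 then f m.+1 \o orbit_map f m else id.

Definition birkhoff_sum (R : realType) (X : Type) (f : nat -> X -> X)
    (phi : X -> R) (n : nat) (x : X) : R :=
  \sum_(j < n) phi (orbit_map f j x).

Definition finite_open_cover (X : topologicalType) (U : set (set X)) : Prop :=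
  [/\ finite_set U, forall V, U V -> open V & [set: X] = \bigcup_(V in U) V].

(** Both suprema are taken in [R], where [sup set0 = 0]; they are genuine
    suprema as soon as the space is bounded, in particular when it is compact.
    For a finite nonempty cover the second one is a maximum. *)
Definition diam (R : realType) (X : metricType R) (A : set X) : R :=
  sup [set mdist p.1 p.2 | p in A `*` A].

Definition mesh (R : realType) (X : metricType R) (U : set (set X)) : R :=
  sup [set diam V | V in U].

Definition strings (X : Type) (U : set (set X)) : set (seq (set X)) :=
  [set s | forall j, (j < size s)%N -> U (nth set0 s j)].

Definition cylinder (X : Type) (f : nat -> X -> X) (s : seq (set X)) : set X :=
  [set x | forall j, (j < size s)%N -> nth set0 s j (orbit_map f j x)].

Definition admissible_length (R : realType) (theta : R) (N m : nat) : Prop :=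
  (N <= m)%N /\ (theta != 0 -> m%:R < N%:R / theta + 1).

(** [ereal_sup set0 = -oo] and [expeR -oo = 0], so a string with an empty
    cylinder has weight [0]. *)
Definition weight (R : realType) (X : Type) (f : nat -> X -> X) (phi : X -> R)
    (alpha : R) (s : seq (set X)) : \bar R :=
  expeR ((- alpha * (size s)%:R)%:E +
    ereal_sup [set (birkhoff_sum f phi (size s) x)%:E | x in cylinder f s])%E.

Definition covering_strings (R : realType) (X : Type) (f : nat -> X -> X)
    (Z : set X) (U : set (set X)) (N : nat) (theta : R)
    (G : set (seq (set X))) : Prop :=
  [/\ countable G,
      G `<=` strings U,
      forall s, G s -> admissible_length theta N (size s)
    & Z `<=` \bigcup_(s in G) cylinder f s].

Definition M (R : realType) (X : Type) (f : nat -> X -> X) (Z : set X)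
    (alpha : R) (phi : X -> R) (U : set (set X)) (N : nat) (theta : R) :
    \bar R :=
  ereal_inf [set \esum_(s in G) weight f phi alpha s
            | G in covering_strings f Z U N theta].

Definition m_lower (R : realType) (X : Type) (f : nat -> X -> X) (Z : set X)
    (alpha : R) (phi : X -> R) (U : set (set X)) (theta : R) : \bar R :=
  limn_einf (fun N => M f Z alpha phi U N theta).

Definition m_upper (R : realType) (X : Type) (f : nat -> X -> X) (Z : set X)
    (alpha : R) (phi : X -> R) (U : set (set X)) (theta : R) : \bar R :=
  limn_esup (fun N => M f Z alpha phi U N theta).

Definition cover_pressure_lower (R : realType) (X : Type) (f : nat -> X -> X)
    (Z : set X) (phi : X -> R) (U : set (set X)) (theta : R) : \bar R :=
  ereal_inf [set alpha%:E | alpha in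
    [set alpha : R | m_lower f Z alpha phi U theta = 0%E]].

Definition cover_pressure_upper (R : realType) (X : Type) (f : nat -> X -> X)
    (Z : set X) (phi : X -> R) (U : set (set X)) (theta : R) : \bar R :=
  ereal_inf [set alpha%:E | alpha in
    [set alpha : R | m_upper f Z alpha phi U theta = 0%E]].

(** The filter "[|U| --> 0]" on finite open covers. *)
Definition mesh_to_0 (R : realType) (X : metricType R) :
    set_system (set (set X)) :=
  filter_from [set delta : R | 0 < delta]
    (fun delta => [set U | finite_open_cover U /\ mesh U < delta]).

Definition pressure_lower (R : realType) (X : metricType R)
    (f : nat -> X -> X) (Z : set X) (phi : X -> R) (theta : R) : \bar R :=
  lim (cover_pressure_lower f Z phi U theta @[U --> @mesh_to_0 R X]).

Definition pressure_upper (R : realType) (X : metricType R)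
    (f : nat -> X -> X) (Z : set X) (phi : X -> R) (theta : R) : \bar R :=
  lim (cover_pressure_upper f Z phi U theta @[U --> @mesh_to_0 R X]).

(* Main.v *)
Require Import Defs.
From mathcomp Require Import all_boot all_order all_algebra.
From mathcomp Require Import all_classical all_reals all_analysis.
From mathcomp Require Import lra.
Import Order.TTheory GRing.Theory Num.Theory.
Import numFieldNormedType.Exports.
Local Open Scope classical_set_scope.
Local Open Scope ring_scope.
Set Implicit Arguments.
Unset Strict Implicit.
Unset Printing Implicit Defensive.

(** Let [K] bound [- phi] from above. The pressure is at least [- K] and
    nondecreasing in [theta]. Conversely, for [theta <= eta], truncating at
    length [N / eta] the strings of a cover admissible for [theta] gives a cover
    admissible for [eta]; when the cover has small mesh this only costs a small
    oscillation of [phi] and the removed letters, so that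
      [P(eta) + K <= (P(theta) + K) (1 + 1 / theta - 1 / eta)].
    Together these inequalities force continuity on []0, 1]], also when the
    pressure is [+oo]. Combining truncation with the replacement of a cover by a
    coarser one, the same estimate for [theta = eta] yields the existence of the
    limit as [|U| --> 0]. *)

(** * Weights of strings and the sums [M] *)

Lemma le_esum_image (R : realType) (T T' : choiceType) (P : set T) (e : T -> T')
    (a : T' -> \bar R) (b : T -> \bar R) :
  (forall t, P t -> (a (e t) <= b t)%E) ->
  (\esum_(t in e @` P) a t <= \esum_(t in P) b t)%E.
Proof.
move=> ab; have [[t0 Pt0]|P0] := pselect (exists t, P t); last first.
  have -> : P = set0 by apply/seteqP; split=> // t Pt; case: P0; exists t.
  by rewrite image_set0 !esum_set0.
(* [e] may identify several points; [s] selects one preimage of each value, so the left sum is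
   dominated by a sum over a subset of [P]. *)
pose s t' := xget t0 [set t | P t /\ e t = t'].
have sP t' : (e @` P) t' -> P (s t') /\ e (s t') = t'.
  by move=> [t Pt et]; apply: (@xgetPex _ t0 [set t | P t /\ e t = t']); exists t.
have sinj : set_inj (e @` P) s.
  by move=> x y /set_mem /sP[_ ex] /set_mem /sP[_ ey] sxy; rewrite -ex -ey sxy.
apply: (@le_trans _ _ (\esum_(t in s @` (e @` P)) b t)%E).
  rewrite (esum_image _ s)//; apply: le_esum => t' Pt'.
  by have [Ps es] := sP _ Pt'; rewrite -{1}es; exact: ab.
apply: ereal_sup_le => _ [A [finA AP] <-]; exists A => //; split=> // t /AP.
by move=> [t' /sP[Ps _] <-].
Qed.

Lemma birkhoff_sum_le (R : realType) (X : Type) (f : nat -> X -> X)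
    (phi : X -> R) (K omega : R) (m k : nat) (x y : X) :
  (forall z, - K <= phi z) ->
  (forall j, (j < m)%N ->
    phi (orbit_map f j x) <= phi (orbit_map f j y) + omega) ->
  birkhoff_sum f phi m x
    <= birkhoff_sum f phi (m + k) y + m%:R * omega + k%:R * K.
Proof.
move=> phiK xy; rewrite /birkhoff_sum big_split_ord/=.
have h1 : \sum_(j < m) phi (orbit_map f j x) <=
    \sum_(j < m) phi (orbit_map f j y) + m%:R * omega.
  rewrite -[m%:R * omega](_ : \sum_(j < m) omega = _); last first.
    by rewrite sumr_const card_ord mulr_natl.
  by rewrite -big_split/=; apply: ler_sum => j _; exact: xy.
have h2 : - (k%:R * K) <= \sum_(j < k) phi (orbit_map f (m + j) y).
  rewrite -mulrN -[k%:R * - K](_ : \sum_(j < k) - K = _); last first.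
    by rewrite sumr_const card_ord mulr_natl.
  exact: ler_sum.
lra.
Qed.

(** Bounding the supremum in the weight of [s] from below takes a single point [y] of its cylinder,
    whereas every point of the cylinder of [s'] must be controlled. *)
Lemma weight_le (R : realType) (X : Type) (f : nat -> X -> X) (phi : X -> R)
    (alpha alpha' : R) (s s' : seq (set X)) (y : X) :
  cylinder f s y ->
  (forall x, cylinder f s' x ->
    - alpha' * (size s')%:R + birkhoff_sum f phi (size s') x
      <= - alpha * (size s)%:R + birkhoff_sum f phi (size s) y) ->
  (weight f phi alpha' s' <= weight f phi alpha s)%E.
Proof.
move=> sy s'x; rewrite /weight lee_expeR.
pose c := - alpha * (size s)%:R + birkhoff_sum f phi (size s) y
          + alpha' * (size s')%:R.
apply: (@le_trans _ _ ((- alpha' * (size s')%:R)%:E + c%:E)%E).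
  rewrite leeD2l//; apply: ge_ereal_sup => _ [x s'x_ <-].
  by rewrite lee_fin /c; have := s'x _ s'x_; lra.
rewrite -EFinD (_ : _ + c = - alpha * (size s)%:R +
  birkhoff_sum f phi (size s) y); last by rewrite /c; lra.
by rewrite EFinD leeD2l//; apply: ereal_sup_ubound; exists y.
Qed.

Lemma weight_ge0 (R : realType) (X : Type) (f : nat -> X -> X) (phi : X -> R)
    (alpha : R) (s : seq (set X)) : (0 <= weight f phi alpha s)%E.
Proof. exact: expeR_ge0. Qed.

Lemma M_ge0 (R : realType) (X : Type) (f : nat -> X -> X) (Z : set X)
    (alpha : R) (phi : X -> R) (U : set (set X)) (N : nat) (theta : R) :
  (0 <= M f Z alpha phi U N theta)%E.
Proof.
apply: le_ereal_inf_tmp => _ [G _ <-]; apply: esum_ge0 => s _.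
exact: weight_ge0.
Qed.

(** Some string of the collection has a given point of [Z] in its cylinder; its exponent is at least
    its length times [- K - alpha], hence nonnegative, and this one term is already at least 1. *)
Lemma M_ge1 (R : realType) (X : Type) (f : nat -> X -> X) (Z : set X)
    (alpha : R) (phi : X -> R) (U : set (set X)) (N : nat) (theta K : R) :
  Z !=set0 -> (forall x, - K <= phi x) -> alpha <= - K ->
  (1 <= M f Z alpha phi U N theta)%E.
Proof.
move=> [z Zz] phiK aK; apply: le_ereal_inf_tmp => _ [G [_ _ _ GZ] <-].
have [s Gs sz] := GZ _ Zz.
apply: (@le_trans _ _ (\esum_(t in [set s]) weight f phi alpha t)%E); last first.
  by apply: ereal_sup_le => _ [A [finA As] <-]; exists A => //;
    split=> // t /As ->.
rewrite esum_set1 ?weight_ge0// -expeR0 /weight lee_expeR.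
apply: (@le_trans _ _ ((- alpha * (size s)%:R)%:E +
    (birkhoff_sum f phi (size s) z)%:E)%E); last first.
  by rewrite leeD2l//; apply: ereal_sup_ubound; exists z.
rewrite lee_fin.
have : (size s)%:R * - K <= birkhoff_sum f phi (size s) z.
  rewrite -[_ * - K](_ : \sum_(j < size s) - K = _); last first.
    by rewrite sumr_const card_ord mulr_natl.
  exact: ler_sum.
have : 0 <= (size s)%:R * (- K - alpha) by rewrite mulr_ge0//; lra.
lra.
Qed.

(** * Refinement and truncation of strings *)

Definition refines (X : Type) (V U : set (set X)) : Prop :=
  forall A, V A -> exists2 B, U B & A `<=` B.

Definition oscillation_le (R : realType) (X : Type) (phi : X -> R) (omega : R)
    (U : set (set X)) : Prop :=
  forall A x y, U A -> A x -> A y -> phi x <= phi y + omega.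

(* Each string of [V] is cut off after [N / eta] letters, which are then
   enlarged to elements of [U]; at most [N / theta - N / eta + 2] letters are
   lost, each of them costing at most [K + alpha] in the exponent. *)
Lemma M_transfer (R : realType) (X : Type) (f : nat -> X -> X) (Z : set X)
    (phi : X -> R) (U V : set (set X)) (K omega alpha alpha' theta eta : R)
    (N : nat) :
  (forall x, - K <= phi x) -> refines V U -> oscillation_le phi omega U ->
  0 < theta -> theta <= eta -> eta <= 1 -> 0 <= K + alpha ->
  alpha + omega <= alpha' ->
  (K + alpha) * ((theta^-1 - eta^-1) * N%:R + 2)
    <= (alpha' - alpha - omega) * N%:R ->
  (M f Z alpha' phi U N eta <= M f Z alpha phi V N theta)%E.
Proof.
move=> phiK VU oscU theta0 thetaeta eta1 Ka aa' KN.
have eta0 : 0 < eta by exact: lt_le_trans thetaeta.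
have delta0 : 0 <= theta^-1 - eta^-1 by rewrite subr_ge0 lef_pV2.
pose g A := xget set0 [set B | U B /\ A `<=` B].
have gP A : V A -> U (g A) /\ A `<=` g A.
  move=> /VU[B UB AB].
  by apply: (@xgetPex _ set0 [set B | U B /\ A `<=` B]); exists B.
pose L := Num.truncn (N%:R / eta).
have Neta0 : 0 <= N%:R / eta by rewrite divr_ge0// ltW.
(* Since [eta <= 1], cutting at [L] never brings a string below the minimal length [N]. *)
have NL : (N <= L)%N.
  by rewrite truncn_ge_nat// ler_pdivlMr// ler_piMr.
have /andP[L1 L2] := truncn_itv Neta0; rewrite -/L in L1 L2.
pose tau s := map g (take L s).
apply: le_ereal_inf_tmp => _ [G [cG GV Gadm GZ] <-].
(* Truncation may turn an empty cylinder, of weight 0, into a nonempty one; strings with empty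
   cylinder cover nothing and are dropped first. *)
pose G0 := G `&` [set s | cylinder f s !=set0].
have cyltau s x : strings V s -> cylinder f s x -> cylinder f (tau s) x.
  move=> Vs sx j; rewrite size_map => js.
  have js' : (j < size s)%N by apply: leq_trans js _; rewrite size_take_min geq_minr.
  have jL : (j < L)%N by apply: leq_trans js _; rewrite size_take_min geq_minl.
  rewrite (nth_map set0)// nth_take//.
  by apply: (gP _ (Vs _ js')).2; exact: sx.
have Utau s : strings V s -> strings U (tau s).
  move=> Vs j; rewrite size_map => js.
  have js' : (j < size s)%N by apply: leq_trans js _; rewrite size_take_min geq_minr.
  have jL : (j < L)%N by apply: leq_trans js _; rewrite size_take_min geq_minl.
  by rewrite (nth_map set0)// nth_take//; exact: (gP _ (Vs _ js')).1.
(* In the [+ 2], one unit comes from the length bound [N / theta + 1], the other from rounding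
   [N / eta] down to [L]. *)
have sizetau s : admissible_length theta N (size s) ->
    [/\ (N <= size (tau s) <= size s)%N,
        (size (tau s))%:R < N%:R / eta + 1 &
        (size s - size (tau s))%:R <= (theta^-1 - eta^-1) * N%:R + 2 :> R].
  move=> [Ns /(_ (lt0r_neq0 theta0)) sN].
  have dN : 0 <= (theta^-1 - eta^-1) * N%:R by rewrite mulr_ge0.
  rewrite size_map size_take_min; have [Ls|sL] := leqP L (size s).
    rewrite NL Ls natrB//; split=> //; first by apply: le_lt_trans L1 _; lra.
    by rewrite mulrBl ![_^-1 * _]mulrC; move: L2; rewrite -natr1; lra.
  rewrite subnn Ns leqnn; split=> //; last lra.
  apply: le_lt_trans (_ : _ <= L%:R) _; first by rewrite ler_nat ltnW.
  by apply: le_lt_trans L1 _; lra.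
apply: (@le_trans _ _ (\esum_(s in G0) weight f phi alpha s)%E); last first.
  by apply: ereal_sup_le => _ [A [finA AG] <-]; exists A => //; split=> // t /AG[].
apply: (@le_trans _ _ (\esum_(s in tau @` G0) weight f phi alpha' s)%E).
  apply: ereal_inf_lbound; exists (tau @` G0) => //; split.
  - apply: sub_countable cG; apply: card_le_trans (card_image_le _ _) _.
    by apply: subset_card_le => s [].
  - by move=> _ [s [Gs _] <-]; exact/Utau/GV.
  - move=> _ [s [Gs _] <-]; have [/andP[Ns _] sN _] := sizetau _ (Gadm _ Gs).
    by split.
  - move=> z /GZ[s Gs sz]; exists (tau s); last by apply: cyltau => //; exact: GV.
    by exists s => //; split=> //; exists z.
apply: le_esum_image => s [Gs [y sy]]; apply: (weight_le sy) => x sx.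
have [/andP[Nt ts] _] := sizetau _ (Gadm _ Gs).
have ytau := cyltau _ _ (GV _ Gs) sy.
have := @birkhoff_sum_le R X f phi K omega (size (tau s))
  (size s - size (tau s)) x y phiK.
rewrite subnKC// => /(_ _)/wrap[j js|].
  by apply: (oscU (nth set0 (tau s) j)); [exact: Utau (GV _ Gs) _ js|exact: sx|
    exact: ytau].
rewrite -{4}(subnKC ts) natrD.
move: (size s - size (tau s))%:R => k Sxy kle.
(* What remains is [(K + alpha) * k <= (alpha' - alpha - omega) * size (tau s)]; [KN] gives it
   through the upper bound on [k] and [N <= size (tau s)], both coefficients being nonnegative. *)
have : (K + alpha) * k <= (K + alpha) * ((theta^-1 - eta^-1) * N%:R + 2).
  by rewrite ler_wpM2l.
have : (alpha' - alpha - omega) * N%:R <= (alpha' - alpha - omega) * (size (tau s))%:R.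
  by rewrite ler_wpM2l ?ler_nat//; lra.
move: Sxy KN; move: (size (tau s))%:R (birkhoff_sum _ _ _ x) (birkhoff_sum _ _ _ y).
move: (_ * _ + 2) => D t Sx Sy; nra.
Qed.

(* The two properties shared by [limn_einf] and [limn_esup] on which everything
   below depends, so that both pressures are treated at once. *)
Definition nonneg_limit (R : realType) (L : (nat -> \bar R) -> \bar R) : Prop :=
  (forall u v, (forall n, 0 <= u n)%E ->
     (\forall n \near \oo, (u n <= v n)%E) ->
     L v = 0%E -> L u = 0%E) /\
  (forall u, (forall n, 1 <= u n)%E -> L u <> 0%E).

(** * Monotonicity of upper and lower limits *)

Lemma le_limn_esup (R : realType) (u v : nat -> \bar R) :
  (\forall n \near \oo, (u n <= v n)%E) -> (limn_esup u <= limn_esup v)%E.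
Proof.
move=> uv; apply: le_ereal_inf_tmp => _ [A Aoo <-].
(* The upper limit is an infimum over sets of the filter, so [A] may be shrunk to where
   [u n <= v n]. *)
apply: (@le_trans _ _ (ereal_sup (u @` (A `&` [set n | (u n <= v n)%E])))).
  by apply: ereal_inf_lbound; exists (A `&` [set n | (u n <= v n)%E]) => //;
    apply: filterI.
apply: ge_ereal_sup => _ [n [An uvn] <-]; apply: le_trans uvn _.
by apply: ereal_sup_ubound; exists n.
Qed.

Lemma le_limn_einf (R : realType) (u v : nat -> \bar R) :
  (\forall n \near \oo, (u n <= v n)%E) -> (limn_einf u <= limn_einf v)%E.
Proof.
move=> uv; rewrite /limn_einf leeN2; apply: le_limn_esup.
by apply: filterS uv => n; rewrite leeN2.
Qed.

(** Comparison with the constant sequences 0 and 1 suffices. *)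
Lemma nonneg_limit_monotone (R : realType) (L : (nat -> \bar R) -> \bar R) :
  (forall l, L (fun=> l) = l) ->
  (forall u v, (\forall n \near \oo, (u n <= v n)%E) -> (L u <= L v)%E) ->
  nonneg_limit L.
Proof.
move=> Lcst Lle; split=> [u v u0 uv Lv|u u1 Lu].
  apply/eqP; rewrite eq_le -{1}Lv Lle//= -[leLHS]Lcst; apply: Lle.
  exact: nearW.
have : (1 <= L u)%E by rewrite -[leLHS]Lcst; apply: Lle; exact: nearW.
by rewrite Lu lee_fin ler10.
Qed.

Lemma nonneg_limit_esup (R : realType) : nonneg_limit (@limn_esup R).
Proof.
apply: nonneg_limit_monotone => [l|]; last exact: le_limn_esup.
exact: (cvg_limn_einf_sup (cvg_cst l)).2.
Qed.

Lemma nonneg_limit_einf (R : realType) : nonneg_limit (@limn_einf R).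
Proof.
apply: nonneg_limit_monotone => [l|]; last exact: le_limn_einf.
exact: (cvg_limn_einf_sup (cvg_cst l)).1.
Qed.

(** At [limn_einf] and [limn_esup] this unfolds to [cover_pressure_lower] and
    [cover_pressure_upper], so results for a general [L] apply to both by conversion. *)
Definition cover_pressure (R : realType) (L : (nat -> \bar R) -> \bar R)
    (X : Type) (f : nat -> X -> X) (Z : set X) (phi : X -> R)
    (U : set (set X)) (theta : R) : \bar R :=
  ereal_inf [set alpha%:E | alpha in
    [set alpha : R | L (fun N => M f Z alpha phi U N theta) = 0%E]].

Definition pressure (R : realType) (L : (nat -> \bar R) -> \bar R)
    (X : metricType R) (f : nat -> X -> X) (Z : set X) (phi : X -> R)
    (theta : R) : \bar R :=
  lim (cover_pressure L f Z phi U theta @[U --> @mesh_to_0 R X]).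

(** * Pressure relative to a fixed cover *)

Section cover_pressure.
Context (R : realType) (L : (nat -> \bar R) -> \bar R) (HL : nonneg_limit L).
Context (X : Type) (f : nat -> X -> X) (Z : set X) (phi : X -> R) (K : R).
Hypotheses (Z0 : Z !=set0) (phiK : forall x, - K <= phi x).

(** Decreasing [theta] raises the length bound [N / theta + 1], which admits more collections and
    lowers [M]. *)
Lemma le_cover_pressure (U : set (set X)) (theta eta : R) :
  0 < theta -> theta <= eta ->
  (cover_pressure L f Z phi U theta <= cover_pressure L f Z phi U eta)%E.
Proof.
move=> theta0 le_te; have eta0 : 0 < eta by exact: lt_le_trans le_te.
apply: le_ereal_inf => _ [a /= a0 <-]; exists a => //=.
apply: HL.1 a0 => [n|]; first exact: M_ge0.
apply: nearW => N; apply: le_ereal_inf => _ [G [cG GU Gadm GZ] <-].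
exists G => //; split=> // s /Gadm[Ns sN]; split=> // _.
apply: lt_le_trans (sN (lt0r_neq0 eta0)) _.
by rewrite lerD2r ler_wpM2l// lef_pV2.
Qed.

Lemma cover_pressure_gt (U : set (set X)) (theta alpha : R) :
  L (fun N => M f Z alpha phi U N theta) = 0%E -> - K < alpha.
Proof.
move=> La; rewrite ltNge; apply/negP => aK; apply: HL.2 La => N.
exact: M_ge1.
Qed.

Lemma cover_pressure_ge (U : set (set X)) (theta : R) :
  ((- K)%:E <= cover_pressure L f Z phi U theta)%E.
Proof.
apply: le_ereal_inf_tmp => _ [a /= a0 <-]; rewrite lee_fin ltW//.
exact: cover_pressure_gt a0.
Qed.

(** The part of the truncation loss proportional to [N] yields the factor [theta^-1 - eta^-1]; the
    constant part is absorbed, for large [N], by the gap between [a] and a smaller exponent at which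
    the limit vanishes. *)
Lemma cover_pressure_transfer (U V : set (set X)) (omega theta eta a : R) :
  refines V U -> oscillation_le phi omega U ->
  0 < theta -> theta <= eta -> eta <= 1 -> 0 <= omega ->
  (cover_pressure L f Z phi V theta < a%:E)%E ->
  (cover_pressure L f Z phi U eta
    <= (a + omega + (theta^-1 - eta^-1) * (K + a))%:E)%E.
Proof.
move=> VU oscU theta0 le_te eta1 omega0 /ereal_inf_lt[_ [al /= Lal <-]].
rewrite lte_fin => ala; have Kal := cover_pressure_gt Lal.
have eta0 : 0 < eta by exact: lt_le_trans le_te.
have delta0 : 0 <= theta^-1 - eta^-1 by rewrite subr_ge0 lef_pV2.
have [delta deltaE] : exists d, d = theta^-1 - eta^-1 by eexists.
rewrite -deltaE in delta0 *.
have dK : 0 <= delta * (a - al) by rewrite mulr_ge0//; lra.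
apply: ereal_inf_lbound; eexists; last reflexivity.
apply: HL.1 Lal => [N|]; first exact: M_ge0.
near=> N; apply: (@M_transfer _ _ _ _ _ _ _ K omega) => //.
- lra.
- have : 0 <= delta * (K + a) by rewrite mulr_ge0//; lra.
  lra.
(* From this threshold on, the rounding cost [2 * (K + al)] is at most [(a - al) * N]. *)
- have : 2 * (K + al) / (a - al) <= N%:R.
    by near: N; exact: nbhs_infty_ger.
  rewrite -deltaE ler_pdivrMr ?subr_gt0// => NaK.
  have : 0 <= delta * (a - al) * N%:R by rewrite mulr_ge0.
  by lra.
Unshelve. all: by end_near. Qed.

End cover_pressure.

(** * Compactness and covers of small mesh *)

Section mesh.
Context (R : realType) (X : metricType R).
Hypothesis X_compact : compact [set: X].

Lemma compact_locally_bounded (g : X -> R) :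
  (forall x : X, exists c, \forall y \near x, g y <= c) ->
  exists K, forall x, g x <= K.
Proof.
move=> gloc.
case: ((compact_near_coveringP [set: X]).1 X_compact R (nbhs +oo%R)
  (fun K x => g x <= K)) => [x _|K [_ H]].
  have [c gc] := gloc x.
  exists ([set y | g y <= c], [set K | c <= K]) => /=.
    by split=> //; exact: nbhs_pinfty_ge (num_real _).
  by move=> [y K]/= [gy cK]; exact: le_trans cK.
(* Nearness to [+oo] only gives bounds strictly above [K]. *)
by exists (K + 1) => x; apply: H => //; rewrite ltrDl.
Qed.

Lemma continuous_lower_bound (phi : X -> R) : continuous phi ->
  exists K, forall x, - K <= phi x.
Proof.
move=> cphi; have [K phiK] : exists K, forall x, - phi x <= K.
  apply: compact_locally_bounded => x; exists (1 - phi x).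
  have /cvgrPdist_le/(_ 1 ltr01) := cphi x; apply: filterS => y.
  by rewrite ler_distl => /andP[? ?]; lra.
by exists K => x; rewrite lerNl.
Qed.

(** This bound makes the real suprema in [diam] and [mesh] genuine. *)
Lemma mdist_bounded (p : X) : exists D, forall x y : X, mdist x y <= D.
Proof.
have [D pD] : exists D, forall x, mdist p x <= D.
  apply: compact_locally_bounded => x; exists (mdist p x + 1).
  near=> y; apply: le_trans (metric_triangle p x y) _; rewrite lerD2l.
  suff : ball x 1 y by rewrite ballEmdist/= => /ltW.
  by near: y; exact: nbhsx_ballx.
exists (D + D) => x y; apply: le_trans (metric_triangle x p y) _.
by rewrite lerD// metric_sym.
Unshelve. all: by end_near. Qed.

Lemma mdist_le_diam (A : set X) (x y : X) : A x -> A y -> mdist x y <= diam A.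
Proof.
move=> Ax Ay; have [D XD] := mdist_bounded x.
apply: ub_le_sup; last by exists (x, y).
by exists D => _ [[a b] _ <-]; exact: XD.
Qed.

Lemma diam_le_mesh (p : X) (U : set (set X)) (A : set X) :
  U A -> diam A <= mesh U.
Proof.
move=> UA; have [D XD] := mdist_bounded p.
apply: ub_le_sup; last by exists A.
(* An empty member has [diam] equal to [sup set0 = 0], and [D] is nonnegative because it bounds
   [mdist p p]. *)
exists D => _ [B _ <-]; have [->|/set0P[y By]] := eqVneq B set0.
  rewrite /diam setX0 image_set0 sup0.
  exact: le_trans (mdist_ge0 _ _) (XD p p).
by apply: ge_sup => [|_ [[a b] _ <-]//]; exists (mdist y y), (y, y).
Qed.

(** Near-covering along radii decreasing to 0: if the ball of radius [r] about [x] lies in [A], so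
    does every ball of radius below [r / 2] about a point within [r / 2] of [x]. *)
Lemma lebesgue_number (U : set (set X)) :
  (forall x : X, exists2 A, U A & nbhs x A) ->
  exists2 e : R, 0 < e & forall y : X, exists2 A, U A & ball y e `<=` A.
Proof.
move=> Unbhs.
case: ((compact_near_coveringP [set: X]).1 X_compact R 0^'+
  (fun e y => exists2 A, U A & ball y e `<=` A)) => [x _|e /= e0 H].
  have [A UA /nbhs_ballP[r /= r0 xrA]] := Unbhs x.
  exists (ball x (r / 2), [set e | e < r / 2]) => /=.
    split; first by apply: nbhsx_ballx; rewrite divr_gt0.
    by apply: nbhs_right_lt; rewrite divr_gt0.
  move=> [y e]/= [xy er]; exists A => //; apply: subset_trans xrA => z yz.
  rewrite (splitr r); apply: ball_triangle xy _.
  by apply: le_ball yz; exact: ltW.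
exists (e / 2); first by rewrite divr_gt0.
move=> y; apply: H => //=; last by rewrite divr_gt0.
rewrite sub0r normrN gtr0_norm ?divr_gt0//.
by rewrite ltr_pdivrMr// ltr_pMr// ltr1n.
Qed.

(** Near-covering along the filter [F] of finite sets ordered by inclusion produces one finite [T]
    that serves all points; interiors are used to obtain open sets. *)
Lemma finite_net (e : R) : 0 < e ->
  exists2 T : set X, finite_set T &
    forall y, exists2 p, T p & interior (ball p e) y.
Proof.
move=> e0.
pose F := filter_from (@finite_set X) (fun T => [set T' | T `<=` T']).
have FF : Filter F.
  apply: filter_from_filter; first by exists set0.
  move=> A B finA finB; exists (A `|` B); first by rewrite /= finite_setU.
  by move=> T ABT; split=> x ?; apply: ABT; [left|right].
case: ((compact_near_coveringP [set: X]).1 X_compact _ F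
  (fun T y => exists2 p, T p & interior (ball p e) y)) => [x _|T finT H].
  exists (interior (ball x e), [set T' | [set x] `<=` T']) => /=.
    by split; [exact/nbhs_interior/nbhsx_ballx|exists [set x]].
  by move=> [y T]/= [xy xT]; exists x => //; exact: xT.
by exists T => // y; apply: H.
Qed.

Lemma finite_open_cover_mesh (x0 : X) (delta : R) : 0 < delta ->
  exists2 U : set (set X), finite_open_cover U & mesh U < delta.
Proof.
(* Radius [delta / 4] gives diameters at most [delta / 2], so the supremum [mesh] stays strictly
   below [delta]. *)
move=> d0; have e0 : 0 < delta / 4 by rewrite divr_gt0.
have [T finT Tnet] := finite_net e0.
exists [set interior (ball p (delta / 4)) | p in T].
  split; first exact: finite_image.
    by move=> _ [p _ <-]; exact: open_interior.
  apply/seteqP; split=> // y _; have [p Tp py] := Tnet y.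
  by exists (interior (ball p (delta / 4))) => //; exists p.
apply: le_lt_trans (_ : _ <= delta / 2) _; last first.
  by rewrite ltr_pdivrMr// ltr_pMr// ltr1n.
have [p Tp _] := Tnet x0.
apply: ge_sup.
  exists (diam (interior (ball p (delta / 4)))).
  by exists (interior (ball p (delta / 4))) => //; exists p.
move=> _ [_ [q Tq <-] <-]; apply: ge_sup.
  exists (mdist q q), (q, q) => //; split;
    apply: nbhs_singleton; apply: nbhs_interior; exact: nbhsx_ballx.
move=> _ [[a b] /= [/interior_subset qa /interior_subset qb] <-].
move: qa qb; rewrite !ballEmdist/= => qa qb; have := metric_triangle a q b.
by rewrite (metric_sym a q); lra.
Qed.

#[global] Instance mesh_to_0_filter : Filter (@mesh_to_0 R X).
Proof.
apply: filter_from_filter; first by exists 1 => /=.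
move=> d e /= d0 e0; exists (Num.min d e); first by rewrite /= lt_min d0.
by move=> U [covU]; rewrite lt_min => /andP[Ud Ue].
Qed.

Lemma mesh_to_0_proper (x0 : X) : ProperFilter (@mesh_to_0 R X).
Proof.
apply: filter_from_proper => d d0.
by have [U covU Ud] := finite_open_cover_mesh x0 d0; exists U.
Qed.

Lemma open_cover_nbhs (U : set (set X)) : finite_open_cover U ->
  forall x : X, exists2 A, U A & nbhs x A.
Proof.
move=> [_ oU UX] x; have : [set: X] x by [].
by rewrite UX => -[A UA Ax]; exists A => //; apply: open_nbhs_nbhs; split; [exact: oU|].
Qed.

(** A nonempty set of diameter below the Lebesgue number lies in a ball about any of its points,
    hence in a member of [U]. The family [U] may be infinite, as in the next lemma. *)
Lemma near_mesh_refines (x0 : X) (U : set (set X)) :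
  (forall x : X, exists2 A, U A & nbhs x A) ->
  \forall V \near @mesh_to_0 R X, finite_open_cover V /\ refines V U.
Proof.
move=> Unbhs; have [e e0 Ue] := lebesgue_number Unbhs.
exists e => // V [covV Ve]; split=> // B VB.
have [[y By]|B0] := pselect (B !=set0); last first.
  by have [A UA _] := Ue x0; exists A => // y By; case: B0; exists y.
have [A UA yA] := Ue y; exists A => //; apply: subset_trans yA => z Bz.
rewrite ballEmdist/=; apply: le_lt_trans (mdist_le_diam By Bz) _.
by apply: le_lt_trans Ve; exact: diam_le_mesh.
Qed.

(** Small oscillation amounts to refining the family of all sets on which [phi] varies by at most
    [e]. *)
Lemma near_mesh_oscillation (x0 : X) (phi : X -> R) (e : R) :
  continuous phi -> 0 < e ->
  \forall V \near @mesh_to_0 R X, finite_open_cover V /\ oscillation_le phi e V.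
Proof.
move=> cphi e0.
have : \forall V \near @mesh_to_0 R X, finite_open_cover V /\
    refines V [set A | forall x y, A x -> A y -> phi x <= phi y + e].
  apply: near_mesh_refines => // x; exists (phi @^-1` ball (phi x) (e / 2)).
    move=> y z /=; rewrite -!ball_normE/= !ltr_distl => /andP[? ?] /andP[? ?].
    lra.
  by apply: cphi; apply: nbhsx_ballx; rewrite divr_gt0.
apply: filterS => V [covV VA]; split=> // A x y /VA[B BP AB] Ax Ay.
by apply: BP; exact: AB.
Qed.

End mesh.

(** * Convergence in the extended reals *)

Lemma ereal_between (R : realType) (x y : \bar R) : (x < y)%E ->
  exists2 r : R, (x < r%:E)%E & (r%:E < y)%E.
Proof.
case: x y => [x||] [y||]// xy.
- by rewrite lte_fin in xy; exists ((x + y) / 2); rewrite lte_fin; lra.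
- by exists (x + 1); rewrite ?ltry// lte_fin ltrDl.
- by exists (y - 1); rewrite ?ltNyr// lte_fin gtrBl.
- by exists 0; rewrite ?ltNyr// ltry.
Qed.

Lemma cvge_between (R : realType) (T : Type) (F : set_system T) (u : T -> \bar R)
    (l : \bar R) : Filter F -> (-oo < l)%E ->
  (forall c : R, (c%:E < l)%E -> \forall t \near F, (c%:E <= u t)%E) ->
  (forall b : R, (l < b%:E)%E -> \forall t \near F, (u t <= b%:E)%E) ->
  u t @[t --> F] --> l.
Proof.
move=> FF; case: l => [l _ lo up|_ lo _|//]; last first.
  by apply/cvgeyPge => A; apply: lo; exact: ltry.
apply/fine_cvgP; split.
  have := lo (l - 1); have := up (l + 1).
  rewrite !lte_fin ltrDl gtrBl => /(_ ltr01) up1 /(_ ltr01) lo1.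
  apply: filterS2 up1 lo1 => t ul lu; rewrite fin_numE.
  by apply/andP; split; apply/eqP => ut; move: ul lu; rewrite ut.
apply/cvgrPdist_le => e e0.
have := lo (l - e); have := up (l + e).
rewrite !lte_fin ltrDl gtrBl => /(_ e0) up1 /(_ e0) lo1.
apply: filterS2 up1 lo1 => t /=; case: (u t) => [r||]//.
by rewrite !lee_fin/= ler_distl => *; lra.
Qed.

(** * Existence of the limit and continuity in [theta] *)

Section pressure.
Context (R : realType) (L : (nat -> \bar R) -> \bar R) (HL : nonneg_limit L).
Context (X : metricType R) (f : nat -> X -> X) (Z : set X) (phi : X -> R).
Hypotheses (X_compact : compact [set: X]) (cphi : continuous phi).
Hypothesis (Z0 : Z !=set0).

Let P := pressure L f Z phi.

Lemma cvg_cover_pressure (theta : R) : 0 < theta -> theta <= 1 ->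
  cover_pressure L f Z phi U theta @[U --> @mesh_to_0 R X] --> P theta.
Proof.
move=> theta0 theta1; have [x0 _] := Z0.
have FF : ProperFilter (@mesh_to_0 R X) by exact: mesh_to_0_proper x0.
have [K phiK] := continuous_lower_bound X_compact cphi.
suff [l ul] : exists l : \bar R,
    cover_pressure L f Z phi U theta @[U --> @mesh_to_0 R X] --> l.
  by rewrite /P /pressure (cvg_lim _ ul).
set u := fun U => cover_pressure L f Z phi U theta.
(* The candidate is the lower limit along the filter, the supremum of the eventual lower bounds. *)
exists (ereal_sup [set x | \forall U \near @mesh_to_0 R X, (x <= u U)%E]).
have uK U : ((- K)%:E <= u U)%E by exact: cover_pressure_ge.
apply: cvge_between.
- apply: lt_le_trans (ltNyr (- K)) _; apply: ereal_sup_ubound; exact: nearW.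
- move=> c /ereal_sup_gt[x /= xu cx]; apply: filterS xu => U.
  exact/le_trans/ltW.
- move=> b /ereal_between[a la ab]; rewrite lte_fin in ab.
  have : 0 < b - a by rewrite subr_gt0.
  move=> /(near_mesh_oscillation X_compact x0 cphi); apply: filterS => U [covU oscU].
  (* Some refinement [V] of [U] has [u V < a], since otherwise [a] would be an eventual lower bound
     above the candidate; transfer from [V] to [U] at equal parameters then costs only the
     oscillation [b - a]. *)
  have [[V [VU Va]]|noV] := pselect (exists V, refines V U /\ (u V < a%:E)%E).
    have := cover_pressure_transfer HL Z0 phiK VU oscU theta0 (lexx _) theta1 _ Va.
    rewrite subrr mul0r addr0 addrCA subrr addr0; apply.
    by rewrite subr_ge0 ltW.
  exfalso; move: la; rewrite ltNge => /negP; apply; apply: ereal_sup_ubound => /=.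
  have := near_mesh_refines X_compact x0 (open_cover_nbhs covU).
  apply: filterS => V [_ VU].
  by rewrite leNgt; apply/negP => Va; apply: noV; exists V.
Qed.

Lemma near_cover_pressure_lt (theta : R) (x : \bar R) :
  0 < theta -> theta <= 1 -> (P theta < x)%E ->
  \forall U \near @mesh_to_0 R X, (cover_pressure L f Z phi U theta < x)%E.
Proof.
move=> theta0 theta1 Px.
have Px_nbhs : nbhs (P theta) [set y | (y < x)%E].
  by apply: open_nbhs_nbhs; split => //; exact: open_ereal_lt_ereal.
exact: (cvg_cover_pressure theta0 theta1 Px_nbhs).
Qed.

Lemma le_pressure (theta eta : R) : 0 < theta -> theta <= eta -> eta <= 1 ->
  (P theta <= P eta)%E.
Proof.
move=> theta0 le_te eta1; have [x0 _] := Z0.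
have FF : ProperFilter (@mesh_to_0 R X) by exact: mesh_to_0_proper x0.
have eta0 := lt_le_trans theta0 le_te.
rewrite leNgt; apply/negP => /ereal_between[r Pr]; rewrite ltNge => /negP; apply.
apply: (cvge_to_le (cvg_cover_pressure theta0 (le_trans le_te eta1))).
apply: filterS (near_cover_pressure_lt eta0 eta1 Pr) => U /ltW.
by apply: le_trans; exact: le_cover_pressure.
Qed.

Lemma pressure_bounds : exists K : R,
  (forall theta, 0 < theta -> theta <= 1 -> ((- K)%:E <= P theta)%E) /\
  forall theta eta a, 0 < theta -> theta <= eta -> eta <= 1 ->
    (P theta < a%:E)%E ->
    (P eta <= (a + (theta^-1 - eta^-1) * (K + a))%:E)%E.
Proof.
have [x0 _] := Z0.
have FF : ProperFilter (@mesh_to_0 R X) by exact: mesh_to_0_proper x0.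
have [K phiK] := continuous_lower_bound X_compact cphi.
exists K; split=> [theta theta0 theta1|theta eta a theta0 le_te eta1 Pa].
  apply: (cvge_to_ge (cvg_cover_pressure theta0 theta1)).
  by apply: nearW => U; exact: cover_pressure_ge.
apply/lee_addgt0Pr => e e0.
apply: (cvge_to_le (cvg_cover_pressure (lt_le_trans theta0 le_te) eta1)).
have ua := near_cover_pressure_lt theta0 (le_trans le_te eta1) Pa.
apply: filterS2 ua (near_mesh_oscillation X_compact x0 cphi e0) => U Ua [_ oscU].
rewrite -EFinD addrAC.
(* With [V = U], transfer compares two parameters on a single cover; its oscillation cost [e] is
   arbitrary. *)
have UU : refines U U by move=> A UA; exists A.
exact: (cover_pressure_transfer HL Z0 phiK UU oscU theta0 le_te eta1 (ltW e0) Ua).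
Qed.

Lemma pressure_continuous : {within `]0, 1], continuous P}.
Proof.
have [K [PK Ptr]] := pressure_bounds.
apply/subspace_continuousP => t; rewrite /= in_itv/= => /andP[t0 t1].
have near_inv k e : 0 < e ->
    \forall s \near t, `|(s^-1 - t^-1) * k| <= e.
  move=> e0.
  have : (s^-1 * k) @[s --> t] --> t^-1 * k.
    by apply: cvgMl; apply: cvgV; [rewrite gt_eqF|exact: cvg_id].
  move=> /cvgrPdist_le/(_ e e0); apply: filterS => s.
  by rewrite -mulrBl -normrN -mulNr opprB.
apply: cvge_between.
- by apply: lt_le_trans (ltNyr (- K)) _; exact: PK.
- move=> c /ereal_between[c' cc' c't]; rewrite lte_fin in cc'.
  have cc'0 : 0 < c' - c by rewrite subr_gt0.
  rewrite near_withinE; apply: filterS (near_inv (K + c) _ cc'0) => s sc.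
  rewrite /mkset in_itv/= => /andP[s0 s1].
  have [ts|st] := leP t s.
    by apply: le_trans (le_pressure t0 ts s1); apply: ltW; apply: lt_trans c't.
  (* If [P s < c], transfer from [s] up to [t] costs at most [c' - c] and forces [P t <= c']. *)
  rewrite leNgt; apply/negP => Psc.
  have := Ptr _ _ _ s0 (ltW st) t1 Psc; rewrite leNgt => /negP; apply.
  apply: le_lt_trans c't; rewrite lee_fin -lerBrDl.
  exact: le_trans (ler_norm _) sc.
- move=> b /ereal_between[a ta ab]; rewrite lte_fin in ab.
  have ab0 : 0 < b - a by rewrite subr_gt0.
  rewrite near_withinE; apply: filterS (near_inv (K + a) _ ab0) => s sa.
  rewrite /mkset in_itv/= => /andP[s0 s1].
  have [ts|st] := leP t s; last first.
    by apply: le_trans (le_pressure s0 (ltW st) t1) _; apply: ltW;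
      apply: lt_trans ta _; rewrite lte_fin.
  (* Transfer from [t] up to [s], started at [a], costs at most [b - a]. *)
  apply: le_trans (Ptr _ _ _ t0 ts s1 ta) _.
  rewrite lee_fin -lerBrDl; apply: le_trans sa.
  by rewrite -normrN -mulNr opprB ler_norm.
Qed.

End pressure.

Unset Implicit Arguments.

Theorem corollary2p7 (R : realType) (X : metricType R)
    (f : nat -> X -> X) (phi : X -> R) (Z : set X)
    (X_compact : compact [set: X])
    (f_continuous : forall i, (1 <= i)%N -> continuous (f i))
    (phi_continuous : continuous phi)
    (Z_nonempty : Z !=set0) :
  {within `]0, 1], continuous (fun theta : R => pressure_lower f Z phi theta)} /\
  {within `]0, 1], continuous (fun theta : R => pressure_upper f Z phi theta)}.
Proof.
split.
- exact: (pressure_continuous (@nonneg_limit_einf R)).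
- exact: (pressure_continuous (@nonneg_limit_esup R)).
Qed.
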